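(* Let $(A,\mu,\alpha,\beta)$ be a unitary BiHom-associative algebra with unit $1$ such that $\alpha,\beta$ are bijective, and let $\psi,\omega:A\to A$ be linear maps, each commuting with both $\alpha$ and $\beta$, such that $\psi(ab)=\psi(a)\psi(b)$, $\omega(ab)=\omega(a)\omega(b)$ for all $a,b\in A$, and $\psi(1)=\omega(1)=1$. Let $r,s\in A\otimes A$ be $\alpha,\beta,\psi,\omega$-invariant, and define linear maps $\delta_r,\delta_s,\Delta:A\to A\otimes A$ by $$\delta_{r}(a)=\alpha^{-1}(a)\triangleright r-r\triangleleft\beta^{-1}(a),\quad \delta_{s}(a)=\alpha^{-1}(a)\triangleright s-s\triangleleft\beta^{-1}(a),\quad \Delta(a)=\alpha^{-1}(a)\triangleright r-s\triangleleft\beta^{-1}(a).$$ Then $(A,\mu,\delta_{r},\delta_{s},\Delta,\alpha,\beta,\psi,\omega)$ is a unitary quasitriangular covariant BiHom-bialgebra if and only if $$\omega(r^{1})\otimes1\otimes\psi(r^{2})=r_{13}r_{12}-r_{12}r_{23}+r_{23}r_{13},$$ or equivalently, if and only if both $$(\omega\otimes\Delta)(r)=r_{13}r_{12}$$ and $$(\Delta\otimes\psi)(r)=-r_{23}r_{13}+1\otimes r^{1}\otimes r^{2}+\omega(r^{1})\otimes1\otimes\psi(r^{2})$$ hold.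
   Context: $K$ is a field; everything is $K$-linear; elements of $A\otimes A$ are written $r=r^1\otimes r^2$ with summation understood, and juxtaposition of maps denotes composition. A BiHom-associative algebra $(A,\mu,\alpha,\beta)$ is a vector space $A$ with linear maps $\mu:A\otimes A\to A$, $\mu(a\otimes b)=ab$, and $\alpha,\beta:A\to A$ with $\alpha\beta=\beta\alpha$, $\alpha(ab)=\alpha(a)\alpha(b)$, $\beta(ab)=\beta(a)\beta(b)$, $\alpha(a)(bc)=(ab)\beta(c)$. It is unitary with unit $1\in A$ if $\alpha(1)=\beta(1)=1$, $a1=\alpha(a)$, $1a=\beta(a)$. A BiHom-coassociative coalgebra $(A,\Delta,\psi,\omega)$: $\psi\omega=\omega\psi$, $(\psi\otimes\psi)\Delta=\Delta\psi$, $(\omega\otimes\omega)\Delta=\Delta\omega$, $(\Delta\otimes\psi)\Delta=(\omega\otimes\Delta)\Delta$. Actions on $A\otimes A$: $a\triangleright(x\otimes y)=\omega(a)x\otimes\beta(y)$, $(x\otimes y)\triangleleft a=\alpha(x)\otimes y\psi(a)$. $r$ is $F$-invariant if $(F\otimes F)(r)=r$. For $r,s\in A\otimes A$ (independent copies if equal): $r_{12}s_{23}=\alpha(r^{1})\otimes r^{2}s^{1}\otimes\beta(s^{2})$, $\;r_{13}s_{12}=\omega(r^{1})s^{1}\otimes\beta(s^{2})\otimes\alpha\psi(r^{2})$, $\;r_{23}s_{13}=\beta\omega(s^{1})\otimes\alpha(r^{1})\otimes r^{2}\psi(s^{2})$. A BiHom-derivation is a linear map $\delta:A\to A\otimes A$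 with $(F\otimes F)\delta=\delta F$ for $F\in\{\alpha,\beta,\psi,\omega\}$ and $\delta(ab)=a\triangleright\delta(b)+\delta(a)\triangleleft b$. A covariant BiHom-bialgebra $(A,\mu,\delta_1,\delta_2,\Delta,\alpha,\beta,\psi,\omega)$: $\delta_1,\delta_2$ are BiHom-derivations, $(A,\mu,\alpha,\beta)$ is a BiHom-associative algebra, $(A,\Delta,\psi,\omega)$ is a BiHom-coassociative coalgebra, $\Delta(ab)=\Delta(a)\triangleleft b+a\triangleright\delta_1(b)=a\triangleright\Delta(b)+\delta_2(a)\triangleleft b$ for all $a,b$, each of $\psi,\omega$ commutes with each of $\alpha,\beta$, $(\alpha\otimes\alpha)\Delta=\Delta\alpha$, $(\beta\otimes\beta)\Delta=\Delta\beta$, and $\psi,\omega$ are multiplicative for $\mu$. When $(A,\mu,\alpha,\beta)$ is unitary with $\psi(1)=\omega(1)=1$, it is called unitary if $\Delta(1)=1\otimes1$. With $\delta_r,\delta_s,\Delta$ defined from $r,s$ as in the claim, $(A,\mu,\delta_r,\delta_s,\Delta,\alpha,\beta,\psi,\omega)$ is called a quasitriangular covariant BiHom-bialgebra if $(r,s)$ is an associative BiHom-Yang-Baxter pair of weight $(0,0)$, i.e. $r_{13}r_{12}-r_{12}r_{23}+s_{23}r_{13}=0$ and $s_{13}r_{12}-s_{12}s_{23}+s_{23}s_{13}=0$ (it is then a covariant BiHom-bialgebra).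
   Formalization: Both right-hand conditions are supplemented by s = r − 1⊗1 (forced by Δ(1) = 1⊗1; r = s = 0 on A = K refutes the claim without it), and ψω = ωψ, part of the BiHom-coalgebra definition, is assumed (r = 1⊗1, s = 0 with non-commuting ψ, ω refutes it otherwise). *)

(* Defs.v *)
From HB Require Import structures.
From mathcomp Require Import all_boot all_order all_algebra.
From mathcomp Require Import sesquilinear generic_quotient boolp.
Set Implicit Arguments.
Unset Strict Implicit.
Unset Printing Implicit Defensive.
Import GRing.Theory.
Local Open Scope ring_scope.
Local Open Scope quotient_scope.

(* Algebraic tensor product of two (possibly infinite-dimensional) vector     *)
(* spaces. A sequence [:: (u1, v1); ...; (un, vn)] stands for the formal sum  *)
(* u1 (x) v1 + ... + un (x) vn; a scalar coefficient can be absorbed in a     *)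
(* factor. Two formal sums are identified when no bilinear map separates      *)
(* them, so that the quotient is the universal target of a bilinear map.      *)
Section Tensor.
Variables (K : fieldType) (U V : lmodType K).

Definition fsum_eval (W : lmodType K) (f : U -> V -> W) (s : seq (U * V)) : W :=
  \sum_(p <- s) f p.1 p.2.

Definition fsum_equiv (s t : seq (U * V)) : bool :=
  `[< forall (W : lmodType K) (f : U -> V -> W),
        bilinear_for *:%R *:%R f -> fsum_eval f s = fsum_eval f t >].

Lemma fsum_equivP s t :
  reflect (forall (W : lmodType K) (f : U -> V -> W),
             bilinear_for *:%R *:%R f -> fsum_eval f s = fsum_eval f t)
          (fsum_equiv s t).
Proof. exact: asboolP. Qed.

Lemma fsum_equiv_refl : reflexive fsum_equiv.
Proof. by move=> s; apply/fsum_equivP. Qed.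

Lemma fsum_equiv_sym : symmetric fsum_equiv.
Proof.
by move=> s t; apply/fsum_equivP/fsum_equivP => st W f bf; rewrite st.
Qed.

Lemma fsum_equiv_trans : transitive fsum_equiv.
Proof.
move=> t s u /fsum_equivP st /fsum_equivP tu; apply/fsum_equivP => W f bf.
by rewrite (st _ _ bf) (tu _ _ bf).
Qed.

Canonical fsum_equiv_rel :=
  EquivRel fsum_equiv fsum_equiv_refl fsum_equiv_sym fsum_equiv_trans.

Definition tensor := {eq_quot fsum_equiv}.

HB.instance Definition _ : EqQuotient _ fsum_equiv tensor :=
  EqQuotient.on tensor.
HB.instance Definition _ := Choice.on tensor.

Definition tens (u : U) (v : V) : tensor := \pi_tensor [:: (u, v)].

(* Sweedler-style sum of f t^1 t^2 over a chosen presentation of t as a sum   *)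
(* of pure tensors; by tens_sum_tens and tens_sum_linear the choice does not  *)
(* matter when f is bilinear.                                                 *)
Definition tens_sum (W : lmodType K) (t : tensor) (f : U -> V -> W) : W :=
  fsum_eval f (repr t).

Arguments tens_sum {W} t f.

Lemma fsum_eval_cat (W : lmodType K) (f : U -> V -> W) s t :
  fsum_eval f (s ++ t) = fsum_eval f s + fsum_eval f t.
Proof. exact: big_cat. Qed.

Definition fsum_scale (k : K) (s : seq (U * V)) := [seq (k *: p.1, p.2) | p <- s].

Lemma fsum_eval_scale (W : lmodType K) (f : U -> V -> W) k s :
  bilinear_for *:%R *:%R f ->
  fsum_eval f (fsum_scale k s) = k *: fsum_eval f s.
Proof.
case=> fl _; rewrite /fsum_eval /fsum_scale big_map scaler_sumr.
by apply: eq_bigr => p _; rewrite (scalable_linear (fl p.2)).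
Qed.

Lemma fsum_eval_repr (W : lmodType K) (f : U -> V -> W) s :
  bilinear_for *:%R *:%R f ->
  fsum_eval f (repr (\pi_tensor s)) = fsum_eval f s.
Proof.
move=> bf; have /eqmodP/fsum_equivP := reprK (\pi_tensor s); exact.
Qed.

Lemma pi_tensorP s t :
  (forall (W : lmodType K) (f : U -> V -> W),
     bilinear_for *:%R *:%R f -> fsum_eval f s = fsum_eval f t) ->
  \pi_tensor s = \pi_tensor t.
Proof. by move=> st; apply/eqmodP/fsum_equivP. Qed.

Definition tens0 : tensor := \pi_tensor [::].
Definition tens_add (t u : tensor) : tensor := \pi_tensor (repr t ++ repr u).
Definition tens_scale (k : K) (t : tensor) : tensor :=
  \pi_tensor (fsum_scale k (repr t)).
Definition tens_opp (t : tensor) : tensor := tens_scale (-1) t.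

Lemma tens_addA : associative tens_add.
Proof.
move=> t u v; apply: pi_tensorP => W f bf.
by rewrite !(fsum_eval_cat, fsum_eval_repr) // addrA.
Qed.

Lemma tens_addC : commutative tens_add.
Proof.
by move=> t u; apply: pi_tensorP => W f bf; rewrite !fsum_eval_cat addrC.
Qed.

Lemma tens_add0 : left_id tens0 tens_add.
Proof.
move=> t; rewrite -[RHS]reprK; apply: pi_tensorP => W f bf.
by rewrite fsum_eval_cat fsum_eval_repr // /fsum_eval big_nil add0r.
Qed.

Lemma tens_addN : left_inverse tens0 tens_opp tens_add.
Proof.
move=> t; apply: pi_tensorP => W f bf.
rewrite fsum_eval_cat fsum_eval_repr // fsum_eval_scale // scaleN1r addNr.
by rewrite /fsum_eval big_nil.
Qed.

HB.instance Definition _ :=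
  GRing.isZmodule.Build tensor tens_addA tens_addC tens_add0 tens_addN.

Lemma tens_scaleA a b t : tens_scale a (tens_scale b t) = tens_scale (a * b) t.
Proof.
apply: pi_tensorP => W f bf.
by rewrite !(fsum_eval_scale, fsum_eval_repr) // scalerA.
Qed.

Lemma tens_scale1 : left_id 1 tens_scale.
Proof.
move=> t; rewrite -[RHS]reprK; apply: pi_tensorP => W f bf.
by rewrite fsum_eval_scale // scale1r.
Qed.

Lemma tens_scaleDr : right_distributive tens_scale +%R.
Proof.
move=> k t u; apply: pi_tensorP => W f bf.
by rewrite !(fsum_eval_scale, fsum_eval_cat, fsum_eval_repr) // scalerDr.
Qed.

Lemma tens_scaleDl t : {morph tens_scale^~ t : a b / a + b}.
Proof.
move=> a b; apply: pi_tensorP => W f bf.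
by rewrite !(fsum_eval_scale, fsum_eval_cat, fsum_eval_repr) // scalerDl.
Qed.

HB.instance Definition _ :=
  GRing.Zmodule_isLmodule.Build K tensor
    tens_scaleA tens_scale1 tens_scaleDr tens_scaleDl.

Lemma tens_bilinear : bilinear_for *:%R *:%R tens.
Proof.
have tP (u : U) (v : V) k (t : tensor) (s : seq (U * V)) :
    (forall (W : lmodType K) (f : U -> V -> W), bilinear_for *:%R *:%R f ->
       fsum_eval f s = k *: f u v + fsum_eval f (repr t)) ->
  \pi_tensor s = k *: tens u v + t.
  move=> st; apply: pi_tensorP => W f bf.
  rewrite st // fsum_eval_cat !(fsum_eval_repr, fsum_eval_scale) //.
  by rewrite /fsum_eval big_seq1.
split=> [v k u1 u2|u k v1 v2]; apply: tP => W f [fl fr];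
  rewrite fsum_eval_repr // /fsum_eval !big_seq1 /=.
- exact: fl.
- exact: fr.
Qed.

Lemma tens_sum_linear (W : lmodType K) (f : U -> V -> W) :
  bilinear_for *:%R *:%R f -> linear (fun t => tens_sum t f).
Proof.
move=> bf k t u; rewrite /tens_sum fsum_eval_repr // fsum_eval_cat.
by rewrite fsum_eval_repr // fsum_eval_scale.
Qed.

Lemma tens_sum_tens (W : lmodType K) (f : U -> V -> W) u v :
  bilinear_for *:%R *:%R f -> tens_sum (tens u v) f = f u v.
Proof.
by move=> bf; rewrite /tens_sum fsum_eval_repr // /fsum_eval big_seq1.
Qed.

Lemma tens_sum_id (t : tensor) : tens_sum t tens = t.
Proof.
rewrite -[RHS]reprK /tens_sum; elim: (repr t) => [|[u v] s IHs].
  by rewrite /fsum_eval big_nil.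
rewrite /fsum_eval big_cons -/(fsum_eval _ _) IHs /=.
apply: pi_tensorP => W f bf.
by rewrite fsum_eval_cat !fsum_eval_repr // -fsum_eval_cat.
Qed.

End Tensor.

Notation "u \ox v" := (tens u v) (at level 40, left associativity) : ring_scope.
Notation "\tsum_ ( x , y <- t ) E" := (tens_sum t (fun x y => E))
  (at level 41, x name, y name, t at level 40, E at level 41) : ring_scope.

Definition tens_map (K : fieldType) (U V U' V' : lmodType K)
    (f : U -> U') (g : V -> V') (t : tensor U V) : tensor U' V' :=
  \tsum_(x, y <- t) (f x \ox g y).

(* Triple tensors live in (U (x) V) (x) W; this is the canonical              *)
(* identification, needed because (omega (x) Delta) lands in A (x) (A (x) A). *)
Definition tens_assoc (K : fieldType) (U V W : lmodType K)
    (t : tensor U (tensor V W)) : tensor (tensor U V) W :=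
  \tsum_(x, yz <- t) \tsum_(y, z <- yz) (x \ox y \ox z).

Definition tens_invariant (K : fieldType) (A : lmodType K) (F : A -> A)
    (r : tensor A A) : Prop :=
  tens_map F F r = r.

Section BiHom.
Variables (K : fieldType) (A : lmodType K).
Variable mu : {linear tensor A A -> A}.
Variables alpha beta psi omega : {linear A -> A}.

Local Notation "a '*m*' b" := (mu (a \ox b)) (at level 40, left associativity).

Definition mu_multiplicative (F : A -> A) : Prop :=
  forall a b, F (a *m* b) = F a *m* F b.

Definition bihom_associative : Prop :=
  [/\ alpha \o beta =1 beta \o alpha,
      mu_multiplicative alpha,
      mu_multiplicative beta
    & forall a b c, alpha a *m* (b *m* c) = (a *m* b) *m* beta c].

Definition bihom_unit (one : A) : Prop :=
  [/\ alpha one = one, beta one = one,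
      forall a, a *m* one = alpha a
    & forall a, one *m* a = beta a].

Definition left_act (a : A) (t : tensor A A) : tensor A A :=
  \tsum_(x, y <- t) ((omega a *m* x) \ox beta y).

Definition right_act (t : tensor A A) (a : A) : tensor A A :=
  \tsum_(x, y <- t) (alpha x \ox (y *m* psi a)).

Definition leg12_23 (r s : tensor A A) : tensor (tensor A A) A :=
  \tsum_(r1, r2 <- r) \tsum_(s1, s2 <- s)
    (alpha r1 \ox (r2 *m* s1) \ox beta s2).

Definition leg13_12 (r s : tensor A A) : tensor (tensor A A) A :=
  \tsum_(r1, r2 <- r) \tsum_(s1, s2 <- s)
    ((omega r1 *m* s1) \ox beta s2 \ox alpha (psi r2)).

Definition leg23_13 (r s : tensor A A) : tensor (tensor A A) A :=
  \tsum_(r1, r2 <- r) \tsum_(s1, s2 <- s)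
    (beta (omega s1) \ox alpha r1 \ox (r2 *m* psi s2)).

Definition commutes_with_tens (F : A -> A) (delta : A -> tensor A A) : Prop :=
  tens_map F F \o delta =1 delta \o F.

Definition bihom_coassociative (Delta : A -> tensor A A) : Prop :=
  linear Delta /\
  [/\ psi \o omega =1 omega \o psi,
      commutes_with_tens psi Delta,
      commutes_with_tens omega Delta
    & tens_map Delta psi \o Delta
        =1 (@tens_assoc K A A A) \o tens_map omega Delta \o Delta].

Definition bihom_derivation (delta : A -> tensor A A) : Prop :=
  [/\ linear delta,
      [/\ commutes_with_tens alpha delta, commutes_with_tens beta delta,
          commutes_with_tens psi delta & commutes_with_tens omega delta]
    & forall a b,
        delta (a *m* b) = left_act a (delta b) + right_act (delta a) b].

Record covariant_bihom_bialgebra (delta1 delta2 Delta : A -> tensor A A) :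
    Prop := CovariantBiHomBialgebra {
  cov_derivation1 : bihom_derivation delta1;
  cov_derivation2 : bihom_derivation delta2;
  cov_assoc : bihom_associative;
  cov_coassoc : bihom_coassociative Delta;
  cov_compat1 : forall a b,
    Delta (a *m* b) = right_act (Delta a) b + left_act a (delta1 b);
  cov_compat2 : forall a b,
    Delta (a *m* b) = left_act a (Delta b) + right_act (delta2 a) b;
  cov_psi_alpha : psi \o alpha =1 alpha \o psi;
  cov_psi_beta : psi \o beta =1 beta \o psi;
  cov_omega_alpha : omega \o alpha =1 alpha \o omega;
  cov_omega_beta : omega \o beta =1 beta \o omega;
  cov_alpha_Delta : commutes_with_tens alpha Delta;
  cov_beta_Delta : commutes_with_tens beta Delta;
  cov_psi_mul : mu_multiplicative psi;
  cov_omega_mul : mu_multiplicative omega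
}.

(* Associative BiHom-Yang-Baxter pair of weight (0, 0).                       *)
Definition aBHYB_pair (r s : tensor A A) : Prop :=
  leg13_12 r r - leg12_23 r r + leg23_13 s r = 0 /\
  leg13_12 s r - leg12_23 s s + leg23_13 s s = 0.

(* To be used with delta_r, delta_s, Delta built from r and s.                *)
Definition quasitriangular_covariant_bihom_bialgebra (r s : tensor A A)
    (delta_r delta_s Delta : A -> tensor A A) : Prop :=
  covariant_bihom_bialgebra delta_r delta_s Delta /\ aBHYB_pair r s.

(* Unitality of the coproduct, the unit being part of the BiHom-associative   *)
(* algebra and fixed by psi and omega.                                        *)
Definition unitary_coproduct (one : A) (Delta : A -> tensor A A) : Prop :=
  Delta one = one \ox one.

End BiHom.

(* Main.v *)
From HB Require Import structures.
Require Import Defs.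
From mathcomp Require Import all_boot all_order all_algebra.
From mathcomp Require Import sesquilinear boolp.
Import GRing.Theory.
Local Open Scope ring_scope.

(** Everything rests on the map
    D_(p, q) (a) = alpha^-1 (a) |> p - q <| beta^-1 (a) attached to two invariant tensors p and q ([inner_map]); the maps of the
    theorem are delta_r = D_(r, r), delta_s = D_(s, s) and Delta = D_(r, s).

    The two actions make A (x) A a bimodule up to twists: applying two left
    actions, two right actions, or one of each in either order is governed by
    BiHom-associativity ([left_act_mul], [right_act_mul], [left_right_act]).
    A difference of a left and a right action therefore satisfies the Leibniz
    rule D_(p, q) (ab) = a |> D_(p, t) (b) + D_(t, q) (a) <| b for every t
    ([inner_map_leibniz]), because the two terms in t cancel. With t = p = q
    this says that delta_r and delta_s are derivations, and with t = r or
    t = s it gives the two compatibility conditions on Delta.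

    For invariant t, the legs are what D_(p, q) does to one factor of t:
    (D_(p, q) (x) psi) (t) = t_13 p_12 - q_12 t_23 and
    (omega (x) D_(p, q)) (t) = t_12 p_23 - q_23 t_13
    ([tens_map_inner_psi], [tens_map_omega_inner]). Expanding both sides of
    coassociativity of Delta at a, one common term cancels and the difference
    becomes the first Yang-Baxter equation acted on from the left by a minus the
    second one acted on from the right by a, so that the pair equations imply
    coassociativity ([aBHYB_inner_coassociative]).

    The unit enters at the end. Since Delta (1) = r - s, unitarity of the
    coproduct means s = r - 1 (x) 1. Substituting this in either Yang-Baxter
    equation and expanding bilinearly, all terms that contain a unit cancel
    except omega (r^1) (x) 1 (x) psi (r^2), so both equations become the single
    equation of the theorem ([aBHYB_pair_unit]). Substituting it in the two leg
    formulas with t = r turns each of the conditions on (omega (x) Delta) (r)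
    and (Delta (x) psi) (r) into that same equation ([omega_inner_unit],
    [inner_psi_unit]). *)

(** * Linear maps out of tensor products *)

Section TensorCalculus.
Set Implicit Arguments.
Unset Strict Implicit.
Variable K : fieldType.
Implicit Types U V W X : lmodType K.

Lemma linear_idfun U : linear (fun x : U => x).
Proof. by []. Qed.

Lemma linear_app U V W (h : {linear V -> W}) (g : U -> V) :
  linear g -> linear (fun x => h (g x)).
Proof. by move=> lg k x y; rewrite lg linearP. Qed.

Lemma linear_tensl U V W (g : U -> V) (w : W) :
  linear g -> linear (fun x => g x \ox w).
Proof. by move=> lg k x y; rewrite lg (tens_bilinear V W).1. Qed.

Lemma linear_tensr U V W (g : U -> W) (v : V) :
  linear g -> linear (fun x => v \ox g x).
Proof. by move=> lg k x y; rewrite lg (tens_bilinear V W).2. Qed.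

Lemma linear_tens_sum U V W X (t : tensor U V) (f : X -> U -> V -> W) :
  (forall u v, linear (fun x => f x u v)) ->
  linear (fun x => tens_sum t (f x)).
Proof.
move=> lf k x y; rewrite /tens_sum /fsum_eval scaler_sumr -big_split /=.
by apply: eq_bigr => p _; rewrite lf.
Qed.

Lemma eq_tens_sum U V W (t : tensor U V) (f g : U -> V -> W) :
  (forall u v, f u v = g u v) -> tens_sum t f = tens_sum t g.
Proof. by move=> fg; apply: eq_bigr => p _; apply: fg. Qed.

Lemma linear_tens_sumE U V W X (h : W -> X) (t : tensor U V) (f : U -> V -> W) :
  linear h -> h (tens_sum t f) = tens_sum t (fun u v => h (f u v)).
Proof.
move=> lh; pose hl : {linear W -> X} :=
  HB.pack h (GRing.isLinear.Build _ _ _ _ h lh).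
exact: (linear_sum hl).
Qed.

Lemma tens_sumB U V W (t : tensor U V) (f g : U -> V -> W) :
  tens_sum t (fun u v => f u v - g u v) = tens_sum t f - tens_sum t g.
Proof. by rewrite /tens_sum /fsum_eval sumrB. Qed.

Lemma tens_sum_exchange U V U' V' W (t : tensor U V) (t' : tensor U' V')
    (f : U -> V -> U' -> V' -> W) :
  \tsum_(u, v <- t) tens_sum t' (f u v)
    = \tsum_(u', v' <- t') \tsum_(u, v <- t) f u v u' v'.
Proof. exact: exchange_big. Qed.

Lemma tens_sum_tens_sum U V U' V' W (t : tensor U V)
    (f : U -> V -> tensor U' V') (g : U' -> V' -> W) :
  bilinear_for *:%R *:%R g ->
  tens_sum (tens_sum t f) g = \tsum_(u, v <- t) tens_sum (f u v) g.
Proof. by move=> bg; rewrite (linear_tens_sumE _ _ (tens_sum_linear bg)). Qed.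

Lemma linear_sub U V (f : U -> V) x y : linear f -> f (x - y) = f x - f y.
Proof.
by move=> lf; have := lf (-1) y x; rewrite !scaleN1r ![- _ + _]addrC.
Qed.

Lemma linear_oppE U V (f : U -> V) x : linear f -> f (- x) = - f x.
Proof.
move=> lf; have := linear_sub x x lf; rewrite !subrr => f0.
by have := linear_sub 0 x lf; rewrite f0 !sub0r.
Qed.

Lemma tens_subl U V (u u' : U) (v : V) : (u - u') \ox v = u \ox v - u' \ox v.
Proof. exact: (linear_sub _ _ ((tens_bilinear U V).1 v)). Qed.

Lemma tens_subr U V (u : U) (v v' : V) : u \ox (v - v') = u \ox v - u \ox v'.
Proof. exact: (linear_sub _ _ ((tens_bilinear U V).2 u)). Qed.

(** The device behind all computations below: a map that fixes [t] may be
    inserted in, or removed from, both Sweedler factors of [t] at once. *)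
Lemma tens_sum_invariant U W (F : U -> U) (t : tensor U U) (f : U -> U -> W) :
  linear F -> tens_invariant F t -> bilinear_for *:%R *:%R f ->
  tens_sum t (fun u v => f (F u) (F v)) = tens_sum t f.
Proof.
move=> lF tF bf; rewrite -[in RHS]tF tens_sum_tens_sum //.
by apply: eq_tens_sum => u v; rewrite tens_sum_tens.
Qed.

End TensorCalculus.

(* Maps in a Sweedler-style formula are nested in a syntax-directed way, so
   their linearity in one variable follows from closure under each constructor. *)
Ltac linear_tac :=
  intros; cbv beta;
  repeat first
    [ exact: linear_idfun
    | apply: linear_tens_sum => ? ?
    | apply: linear_tensl
    | apply: linear_tensr
    | apply: linear_app ].

Ltac bilinear_tac := split=> ?; linear_tac.

Section TensorMaps.
Set Implicit Arguments.
Unset Strict Implicit.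
Variable K : fieldType.
Implicit Types U V W : lmodType K.

Lemma tens_map_linear U V U' V' (f : U -> U') (g : V -> V') :
  linear f -> linear g -> linear (tens_map f g).
Proof. by move=> lf lg; apply: tens_sum_linear; bilinear_tac. Qed.

Lemma tens_map_tens U V U' V' (f : U -> U') (g : V -> V') u v :
  linear f -> linear g -> tens_map f g (u \ox v) = f u \ox g v.
Proof. by move=> lf lg; apply: tens_sum_tens; bilinear_tac. Qed.

Lemma tens_assoc_linear U V W : linear (@tens_assoc K U V W).
Proof.
apply: tens_sum_linear; split=> [yz|x]; first by linear_tac.
by apply: tens_sum_linear; bilinear_tac.
Qed.

Lemma tens_assoc_tens U V W (x : U) (t : tensor V W) :
  tens_assoc (x \ox t) = \tsum_(y, z <- t) (x \ox y \ox z).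
Proof.
apply: tens_sum_tens; split=> [yz|x']; first by linear_tac.
by apply: tens_sum_linear; bilinear_tac.
Qed.

Lemma tens_sum_mapl U V U' V' W (f : U -> U') (g : V -> V') (t : tensor U V)
    (h : U' -> V' -> W) : bilinear_for *:%R *:%R h ->
  tens_sum (tens_map f g t) h = \tsum_(u, v <- t) h (f u) (g v).
Proof.
move=> bh; rewrite tens_sum_tens_sum //.
by apply: eq_tens_sum => u v; rewrite tens_sum_tens.
Qed.

Lemma tens_assoc_natural U V W U' V' W' (f : U -> U') (g : V -> V')
    (h : W -> W') (x : U) (t : tensor V W) :
  linear f -> linear g -> linear h ->
  tens_assoc (f x \ox tens_map g h t)
    = tens_map (tens_map f g) h (tens_assoc (x \ox t)).
Proof.
move=> lf lg lh; have lfg := tens_map_linear lf lg.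
rewrite !tens_assoc_tens (linear_tens_sumE _ _ (tens_map_linear lfg lh)).
rewrite tens_sum_mapl; last by bilinear_tac.
by apply: eq_tens_sum => y z; rewrite !tens_map_tens.
Qed.

End TensorMaps.

(** * BiHom-associative algebras and the bimodule structure of A (x) A *)

Section BiHomBialgebra.
Variables (K : fieldType) (A : lmodType K).
Variable mu : {linear tensor A A -> A}.
Variables alpha beta psi omega alphai betai : {linear A -> A}.

Local Notation "a '*m*' b" := (mu (a \ox b)) (at level 40, left associativity).
Local Notation "a '|>' t" := (left_act mu beta omega a t)
  (at level 41, right associativity).
Local Notation "t '<|' a" := (right_act mu alpha psi t a)
  (at level 42, left associativity).
Local Notation leg12_23 := (leg12_23 mu alpha beta).
Local Notation leg13_12 := (leg13_12 mu alpha beta psi omega).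
Local Notation leg23_13 := (leg23_13 mu alpha beta psi omega).
Local Notation invariant F := (@tens_invariant K A F).

Hypothesis A_assoc : bihom_associative mu alpha beta.
Hypotheses (alphaK : cancel alpha alphai) (alphaiK : cancel alphai alpha).
Hypotheses (betaK : cancel beta betai) (betaiK : cancel betai beta).
Hypotheses (psi_alpha : psi \o alpha =1 alpha \o psi)
  (psi_beta : psi \o beta =1 beta \o psi)
  (omega_alpha : omega \o alpha =1 alpha \o omega)
  (omega_beta : omega \o beta =1 beta \o omega)
  (psi_omega : psi \o omega =1 omega \o psi).
Hypotheses (psi_mul : mu_multiplicative mu psi)
  (omega_mul : mu_multiplicative mu omega).

Lemma mulA a b c : alpha a *m* (b *m* c) = (a *m* b) *m* beta c.
Proof. by case: A_assoc. Qed.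

Lemma commute_inv (f f' g : A -> A) :
  cancel f f' -> cancel f' f -> g \o f =1 f \o g -> g \o f' =1 f' \o g.
Proof.
move=> fK f'K gf a /=; apply: (canRL fK).
by rewrite -[LHS]/((f \o g) (f' a)) -gf /= f'K.
Qed.

Lemma mul_inv (f f' : A -> A) : cancel f f' -> cancel f' f ->
  mu_multiplicative mu f -> mu_multiplicative mu f'.
Proof. by move=> fK f'K fm a b; apply: (canLR fK); rewrite fm !f'K. Qed.

Lemma beta_alpha a : beta (alpha a) = alpha (beta a).
Proof. by case: A_assoc => ab _ _ _; apply/esym/ab. Qed.

Let beta_alphai a : beta (alphai a) = alphai (beta a).
Proof. exact: (commute_inv alphaK alphaiK beta_alpha). Qed.

Let betai_alpha a : betai (alpha a) = alpha (betai a).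
Proof. by apply/esym/(commute_inv betaK betaiK) => x /=; rewrite beta_alpha. Qed.

Let betai_alphai a : betai (alphai a) = alphai (betai a).
Proof. exact: (commute_inv alphaK alphaiK betai_alpha). Qed.

Let psi_alphaE a : psi (alpha a) = alpha (psi a). Proof. exact: psi_alpha. Qed.
Let psi_betaE a : psi (beta a) = beta (psi a). Proof. exact: psi_beta. Qed.
Let omega_alphaE a : omega (alpha a) = alpha (omega a).
Proof. exact: omega_alpha. Qed.
Let omega_betaE a : omega (beta a) = beta (omega a).
Proof. exact: omega_beta. Qed.
Let psi_omegaE a : omega (psi a) = psi (omega a).
Proof. exact/esym/psi_omega. Qed.
Let psi_alphai a : psi (alphai a) = alphai (psi a).
Proof. exact: (commute_inv alphaK alphaiK psi_alpha). Qed.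
Let psi_betai a : psi (betai a) = betai (psi a).
Proof. exact: (commute_inv betaK betaiK psi_beta). Qed.
Let omega_alphai a : omega (alphai a) = alphai (omega a).
Proof. exact: (commute_inv alphaK alphaiK omega_alpha). Qed.
Let omega_betai a : omega (betai a) = betai (omega a).
Proof. exact: (commute_inv betaK betaiK omega_beta). Qed.

Let alpha_mul a b : alpha (a *m* b) = alpha a *m* alpha b.
Proof. by case: A_assoc => _ am _ _; apply: am. Qed.
Let beta_mul a b : beta (a *m* b) = beta a *m* beta b.
Proof. by case: A_assoc => _ _ bm _; apply: bm. Qed.
Let alphai_mul a b : alphai (a *m* b) = alphai a *m* alphai b.
Proof. exact: (mul_inv alphaK alphaiK alpha_mul). Qed.
Let betai_mul a b : betai (a *m* b) = betai a *m* betai b.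
Proof. exact: (mul_inv betaK betaiK beta_mul). Qed.

(* Oriented so that the normal form of a word in the structure maps has
   alpha^(+-1) outermost, then beta^(+-1), psi and omega. *)
Let bihomE :=
  (alphaK, alphaiK, betaK, betaiK,
   (beta_alpha, beta_alphai, betai_alpha, betai_alphai),
   (psi_alphaE, psi_alphai, psi_betaE, psi_betai),
   (omega_alphaE, omega_alphai, omega_betaE, omega_betai, psi_omegaE),
   (alpha_mul, beta_mul, alphai_mul, betai_mul, psi_mul, omega_mul)).

Lemma left_act_linearr a : linear (left_act mu beta omega a).
Proof. by apply: tens_sum_linear; bilinear_tac. Qed.

Lemma left_act_linearl t : linear (left_act mu beta omega ^~ t).
Proof. by rewrite /left_act; linear_tac. Qed.

Lemma right_act_linearl a : linear (right_act mu alpha psi ^~ a).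
Proof. by apply: tens_sum_linear; bilinear_tac. Qed.

Lemma right_act_linearr t : linear (right_act mu alpha psi t).
Proof. by rewrite /right_act; linear_tac. Qed.

(** The common form of delta_r, delta_s and Delta; the name recalls the inner
    derivation, which is the case p = q. *)
Definition inner_map (p q : tensor A A) (a : A) : tensor A A :=
  (alphai a |> p) - (q <| betai a).

Lemma inner_map_linear p q : linear (inner_map p q).
Proof.
move=> k a b; rewrite /inner_map !linearP left_act_linearl right_act_linearr.
by rewrite scalerBr opprD addrACA.
Qed.

Lemma left_act_tens a x y : a |> x \ox y = (omega a *m* x) \ox beta y.
Proof. by apply: tens_sum_tens; bilinear_tac. Qed.

Lemma right_act_tens x y a : x \ox y <| a = alpha x \ox (y *m* psi a).
Proof. by apply: tens_sum_tens; bilinear_tac. Qed.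

(** The action is a module structure only up to twists: moving BiHom-associativity
    through the first factor leaves a beta there, which the beta of the second
    action matches in the second factor, so beta-invariance absorbs both. *)
Lemma left_act_mul a b t : invariant beta t ->
  a |> b |> t = alphai a *m* b |> t.
Proof.
move=> tb; rewrite {2}/left_act (linear_tens_sumE _ _ (left_act_linearr a)).
rewrite [RHS]/left_act -[RHS](tens_sum_invariant (linearP beta) tb).
  apply: eq_tens_sum => x y; rewrite left_act_tens.
  by rewrite -[omega a](alphaiK) mulA !bihomE.
by bilinear_tac.
Qed.

Lemma right_act_mul a b t : invariant alpha t ->
  t <| a <| b = t <| a *m* betai b.
Proof.
move=> ta; rewrite {2}/right_act.
rewrite (linear_tens_sumE _ _ (right_act_linearl b)).
rewrite [RHS]/right_act -[RHS](tens_sum_invariant (linearP alpha) ta).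
  apply: eq_tens_sum => x y; rewrite right_act_tens.
  by rewrite -[psi b](betaiK) -mulA !bihomE.
by bilinear_tac.
Qed.

Lemma left_right_act a b t : (alphai a |> t) <| b = a |> (t <| betai b).
Proof.
rewrite [in LHS]/left_act (linear_tens_sumE _ _ (right_act_linearl b)).
rewrite [in RHS]/right_act (linear_tens_sumE _ _ (left_act_linearr a)).
apply: eq_tens_sum => x y; rewrite left_act_tens right_act_tens.
by rewrite !bihomE.
Qed.

(** The tensor [t] is free since its two contributions, a |> (t <| b') and
    (a' |> t) <| b, cancel; this freedom is what makes one rule serve for the
    derivations and for both compatibility conditions. *)
Lemma inner_map_leibniz p q t a b :
  invariant beta p -> invariant alpha q ->
  inner_map p q (a *m* b) = (a |> inner_map p t b) + (inner_map t q a <| b).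
Proof.
move=> pb qa; rewrite /inner_map (linear_sub _ _ (left_act_linearr a)).
rewrite (linear_sub _ _ (right_act_linearl b)) left_right_act.
rewrite left_act_mul // right_act_mul // !bihomE.
by rewrite addrA subrK.
Qed.

Lemma tens_map_left_act (F : {linear A -> A}) a t :
  mu_multiplicative mu F -> omega \o F =1 F \o omega -> F \o beta =1 beta \o F ->
  invariant F t -> tens_map F F (a |> t) = F a |> t.
Proof.
move=> Fm Fo Fb Ft; have lF := linearP F.
rewrite [in LHS]/left_act (linear_tens_sumE _ _ (tens_map_linear lF lF)).
rewrite [RHS]/left_act -[RHS](tens_sum_invariant lF Ft).
  apply: eq_tens_sum => x y; rewrite tens_map_tens // Fm.
  by move: (Fo a) (Fb y) => /= -> ->.
by bilinear_tac.
Qed.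

Lemma tens_map_right_act (F : {linear A -> A}) a t :
  mu_multiplicative mu F -> psi \o F =1 F \o psi -> F \o alpha =1 alpha \o F ->
  invariant F t -> tens_map F F (t <| a) = (t <| F a).
Proof.
move=> Fm Fp Fa Ft; have lF := linearP F.
rewrite [in LHS]/right_act (linear_tens_sumE _ _ (tens_map_linear lF lF)).
rewrite [RHS]/right_act -[RHS](tens_sum_invariant lF Ft).
  apply: eq_tens_sum => x y; rewrite tens_map_tens // Fm.
  by move: (Fp a) (Fa x) => /= -> ->.
by bilinear_tac.
Qed.

(** Packages what alpha, beta, psi and omega have in common. *)
Definition structure_map (F : {linear A -> A}) : Prop :=
  mu_multiplicative mu F /\
  [/\ F \o alpha =1 alpha \o F, F \o beta =1 beta \o F,
      F \o psi =1 psi \o F & F \o omega =1 omega \o F].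

Lemma commutes_inner_map (F : {linear A -> A}) p q :
  structure_map F -> invariant F p -> invariant F q ->
  forall a, tens_map F F (inner_map p q a) = inner_map p q (F a).
Proof.
move=> [Fm [Fa Fb Fp Fo]] Fip Fiq a; rewrite /inner_map.
have lF := linearP F; rewrite (linear_sub _ _ (tens_map_linear lF lF)).
have oF x : omega (F x) = F (omega x) by exact/esym/Fo.
have pF x : psi (F x) = F (psi x) by exact/esym/Fp.
rewrite tens_map_left_act // tens_map_right_act //.
move: (commute_inv alphaK alphaiK Fa a) (commute_inv betaK betaiK Fb a).
by move=> /= -> ->.
Qed.

Let structure_alpha : structure_map alpha.
Proof. by split=> //; split=> x /=; rewrite ?bihomE. Qed.
Let structure_beta : structure_map beta.
Proof. by split=> //; split=> x /=; rewrite ?bihomE. Qed.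
Let structure_psi : structure_map psi.
Proof. by split=> //; split=> x /=; rewrite ?bihomE. Qed.
Let structure_omega : structure_map omega.
Proof. by split=> //; split=> x /=; rewrite ?bihomE. Qed.

Definition bihom_invariant (t : tensor A A) : Prop :=
  [/\ invariant alpha t, invariant beta t, invariant psi t & invariant omega t].

Lemma inner_derivation t : bihom_invariant t ->
  bihom_derivation mu alpha beta psi omega (inner_map t t).
Proof.
case=> ta tb tp to; split; first exact: inner_map_linear.
  by split; apply: commutes_inner_map.
by move=> a b; apply: inner_map_leibniz.
Qed.

(** * The legs as partial applications of the actions *)

Lemma leg13_12_act t p : invariant alpha t ->
  \tsum_(x, y <- t) ((alphai x |> p) \ox psi y) = leg13_12 t p.
Proof.
move=> ta; rewrite -[LHS](tens_sum_invariant (linearP alpha) ta).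
  apply: eq_tens_sum => x y.
  rewrite alphaK /left_act (linear_tens_sumE _ _ ((tens_bilinear _ _).1 _)).
  by apply: eq_tens_sum => u v; rewrite !bihomE.
split=> ?; last by linear_tac.
by rewrite /left_act; linear_tac.
Qed.


Lemma tens_assoc_left_act (x a : A) (t : tensor A A) :
  tens_assoc (x \ox (a |> t))
    = \tsum_(u, v <- t) (x \ox (omega a *m* u) \ox beta v).
Proof.
rewrite tens_assoc_tens tens_sum_tens_sum; last by bilinear_tac.
by apply: eq_tens_sum => u v; rewrite tens_sum_tens //; bilinear_tac.
Qed.

Lemma tens_assoc_right_act (x : A) (t : tensor A A) (a : A) :
  tens_assoc (x \ox (t <| a))
    = \tsum_(u, v <- t) (x \ox alpha u \ox (v *m* psi a)).
Proof.
rewrite tens_assoc_tens tens_sum_tens_sum; last by bilinear_tac.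
by apply: eq_tens_sum => u v; rewrite tens_sum_tens //; bilinear_tac.
Qed.

Lemma leg12_23_act t q : invariant beta t -> invariant psi t ->
  \tsum_(x, y <- t) ((q <| betai x) \ox psi y) = leg12_23 q t.
Proof.
move=> tb tp; rewrite [RHS]tens_sum_exchange.
rewrite -[LHS](tens_sum_invariant (linearP beta) tb); last first.
  by rewrite /right_act; bilinear_tac.
rewrite -[RHS](tens_sum_invariant (linearP psi) tp); last by bilinear_tac.
apply: eq_tens_sum => x y.
rewrite betaK /right_act (linear_tens_sumE _ _ ((tens_bilinear _ _).1 _)).
by apply: eq_tens_sum => u v; rewrite !bihomE.
Qed.

Lemma leg12_23_act_assoc t p : invariant alpha t -> invariant omega t ->
  \tsum_(x, y <- t) tens_assoc (omega x \ox (alphai y |> p)) = leg12_23 t p.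
Proof.
move=> ta to; under eq_tens_sum do rewrite tens_assoc_left_act.
rewrite -[LHS](tens_sum_invariant (linearP alpha) ta); last by bilinear_tac.
rewrite -[RHS](tens_sum_invariant (linearP omega) to); last by bilinear_tac.
by apply: eq_tens_sum => x y; apply: eq_tens_sum => u v; rewrite !bihomE.
Qed.

Lemma leg23_13_act_assoc t q : invariant beta t ->
  \tsum_(x, y <- t) tens_assoc (omega x \ox (q <| betai y)) = leg23_13 q t.
Proof.
move=> tb; rewrite [RHS]tens_sum_exchange.
under eq_tens_sum do rewrite tens_assoc_right_act.
rewrite -[LHS](tens_sum_invariant (linearP beta) tb); last by bilinear_tac.
by apply: eq_tens_sum => x y; apply: eq_tens_sum => u v; rewrite !bihomE.
Qed.

(** The leg formula for D_(p, q) in the first factor: the left action of the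
    first factor of [t] on [p] is t_13 p_12, its right action on [q] is
    q_12 t_23, up to structure maps that invariance of [t] moves from one factor
    to the other. *)
Lemma tens_map_inner_psi p q t : bihom_invariant t ->
  tens_map (inner_map p q) psi t = leg13_12 t p - leg12_23 q t.
Proof.
case=> ta tb tp to; rewrite -leg13_12_act // -leg12_23_act // -tens_sumB.
by apply: eq_tens_sum => x y; rewrite tens_subl.
Qed.

Lemma tens_map_omega_inner p q t : bihom_invariant t ->
  tens_assoc (tens_map omega (inner_map p q) t) = leg12_23 t p - leg23_13 q t.
Proof.
case=> ta tb tp to.
rewrite -leg12_23_act_assoc // -leg23_13_act_assoc // -tens_sumB.
rewrite (linear_tens_sumE _ _ (@tens_assoc_linear _ _ _ _)).
apply: eq_tens_sum => x y; rewrite tens_subr.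
exact: (linear_sub _ _ (@tens_assoc_linear _ _ _ _)).
Qed.

(** * Coassociativity *)

(** The actions of A on A (x) A (x) A that the two iterates of D_(p, q) are
    equivariant for; omega and psi occur squared because D_(p, q) is iterated. *)
Definition triple_left_act (a : A) :
    tensor (tensor A A) A -> tensor (tensor A A) A :=
  tens_map (tens_map (fun x => omega (omega a) *m* x) beta) beta.

Definition triple_right_act (t : tensor (tensor A A) A) (a : A) :
    tensor (tensor A A) A :=
  tens_map (tens_map alpha alpha) (fun y => y *m* psi (psi a)) t.

Let linear_mull a : linear (fun x => a *m* x).
Proof. by linear_tac. Qed.
Let linear_mulr a : linear (fun x => x *m* a).
Proof. by linear_tac. Qed.

Lemma triple_left_act_linear a : linear (triple_left_act a).
Proof.
by apply: tens_map_linear; [apply: tens_map_linear|]; try exact: linearP.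
Qed.

Lemma triple_right_act_linear a : linear (triple_right_act ^~ a).
Proof.
by apply: tens_map_linear; [apply: tens_map_linear|]; try exact: linearP.
Qed.

Lemma triple_left_act_tens a t z :
  triple_left_act a (t \ox z) = (omega a |> t) \ox beta z.
Proof.
by apply: tens_map_tens; [apply: tens_map_linear|]; try exact: linearP.
Qed.

Lemma triple_right_act_tens t z a :
  triple_right_act (t \ox z) a = tens_map alpha alpha t \ox (z *m* psi (psi a)).
Proof.
by apply: tens_map_tens; [apply: tens_map_linear|]; try exact: linearP.
Qed.

(** The term in which the element a sits in the middle tensor factor, between
    [q] and [t]; it appears on both sides of coassociativity, through
    [inner_psi_left_act] and [omega_inner_right_act]. *)
Definition middle_term (q t : tensor A A) (a : A) : tensor (tensor A A) A :=
  \tsum_(u, v <- q) \tsum_(x, y <- t)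
    (alpha u \ox (v *m* (psi (omega a) *m* betai x)) \ox beta y).

(** D_(p, q) is evaluated at the product omega (a) t^1. The left action of a
    product is an iterated one, so its a comes out in front; the right action
    leaves a inside, next to t^1. *)
Lemma inner_psi_left_act p q t a : invariant beta p -> bihom_invariant t ->
  tens_map (inner_map p q) psi (a |> t)
    = triple_left_act a (leg13_12 t p) - middle_term q t (betai a).
Proof.
move=> pb [ta tb tp to]; have lD := inner_map_linear p q.
rewrite -leg13_12_act // (linear_tens_sumE _ _ (triple_left_act_linear a)).
rewrite /middle_term tens_sum_exchange.
rewrite -[X in _ - X](tens_sum_invariant (linearP psi) tp); last by bilinear_tac.
rewrite -tens_sumB {1}/left_act.
rewrite (linear_tens_sumE _ _ (tens_map_linear lD (linearP psi))).
apply: eq_tens_sum => x y; rewrite tens_map_tens; [|exact: lD|exact: linearP].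
rewrite /inner_map tens_subl triple_left_act_tens left_act_mul // !bihomE.
congr (_ - _).
rewrite /right_act (linear_tens_sumE _ _ ((tens_bilinear _ _).1 _)).
by apply: eq_tens_sum => u v; rewrite !bihomE.
Qed.

(** Here a multiplies the factor that D_(p, q) does not touch, so it comes out by
    multiplicativity of psi, and the alpha left on the other factor passes
    through D_(p, q) by invariance of [p] and [q]. *)
Lemma inner_psi_right_act p q t a :
  invariant alpha p -> invariant alpha q ->
  tens_map (inner_map p q) psi (t <| a)
    = triple_right_act (tens_map (inner_map p q) psi t) a.
Proof.
move=> pa qa; have lD := inner_map_linear p q.
have lDp := tens_map_linear lD (linearP psi).
rewrite /right_act (linear_tens_sumE _ _ lDp).
rewrite [in RHS]/tens_map (linear_tens_sumE _ _ (triple_right_act_linear a)).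
apply: eq_tens_sum => x y; rewrite tens_map_tens; [|exact: lD|exact: linearP].
by rewrite triple_right_act_tens -(commutes_inner_map structure_alpha) // !bihomE.
Qed.

Lemma omega_inner_left_act p q t a :
  invariant beta p -> invariant beta q ->
  tens_assoc (tens_map omega (inner_map p q) (a |> t))
    = triple_left_act a (tens_assoc (tens_map omega (inner_map p q) t)).
Proof.
move=> pb qb; have lD := inner_map_linear p q.
have loD := tens_map_linear (linearP omega) lD.
have lassoc := @tens_assoc_linear K A A A.
rewrite /left_act (linear_tens_sumE _ _ loD) (linear_tens_sumE _ _ lassoc).
rewrite [in RHS]/tens_map (linear_tens_sumE _ _ lassoc).
rewrite (linear_tens_sumE _ _ (triple_left_act_linear a)).
apply: eq_tens_sum => x y; rewrite tens_map_tens; [|exact: linearP|exact: lD].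
rewrite -(commutes_inner_map structure_beta) // omega_mul.
by apply: (tens_assoc_natural (f := fun z => omega (omega a) *m* z));
  try exact: linearP.
Qed.

(** Mirror image of [inner_psi_left_act]: now it is the right action of a product
    that is an iterated one, and the left action that keeps a inside. *)
Lemma omega_inner_right_act p q t a :
  invariant alpha q -> bihom_invariant t ->
  tens_assoc (tens_map omega (inner_map p q) (t <| a))
    = middle_term t p (alphai a) - triple_right_act (leg23_13 q t) a.
Proof.
move=> qa [ta tb tp to]; have lD := inner_map_linear p q.
have loD := tens_map_linear (linearP omega) lD.
have lassoc := @tens_assoc_linear K A A A.
rewrite -leg23_13_act_assoc // (linear_tens_sumE _ _ (triple_right_act_linear a)).
rewrite /middle_term.
rewrite -[X in X - _](tens_sum_invariant (linearP omega) to); last by bilinear_tac.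
rewrite -tens_sumB {1}/right_act.
rewrite (linear_tens_sumE _ _ loD) (linear_tens_sumE _ _ lassoc).
apply: eq_tens_sum => x y; rewrite tens_map_tens; [|exact: linearP|exact: lD].
rewrite /inner_map tens_subr (linear_sub _ _ lassoc); congr (_ - _).
  rewrite tens_assoc_left_act; apply: eq_tens_sum => u v.
  by rewrite !bihomE -[u in LHS](betaiK u) -mulA !bihomE.
rewrite betai_mul -right_act_mul // omega_alphaE.
apply: (tens_assoc_natural (h := fun z => z *m* psi (psi a)));
  try exact: linearP.
by [].
Qed.

(** With e1 and e2 the left-hand sides of the two Yang-Baxter equations, the
    middle terms cancel and the two sides of coassociativity at a differ by
    e1 acted on by alpha^-1 (a) minus e2 acted on by beta^-1 (a). *)
Lemma aBHYB_inner_coassociative r s :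
  bihom_invariant r -> bihom_invariant s ->
  aBHYB_pair mu alpha beta psi omega r s ->
  bihom_coassociative psi omega (inner_map r s).
Proof.
move=> ri si [eq_r eq_s]; have lD := inner_map_linear r s.
have lDp := tens_map_linear lD (linearP psi).
have loD := tens_map_linear (linearP omega) lD.
have lassoc := @tens_assoc_linear K A A A.
case: (ri) => ra rb rp ro; case: (si) => sa sb sp so.
split; first exact: lD.
split; [exact: psi_omega|exact: commutes_inner_map|exact: commutes_inner_map|].
move=> a /=; rewrite {2 4}/inner_map.
rewrite (linear_sub _ _ lDp) (linear_sub _ _ loD) (linear_sub _ _ lassoc).
rewrite inner_psi_left_act // inner_psi_right_act // tens_map_inner_psi //.
rewrite omega_inner_left_act // omega_inner_right_act // tens_map_omega_inner //.
rewrite betai_alphai.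
have -> : leg13_12 r r = leg12_23 r r - leg23_13 s r.
  by move/eqP: eq_r; rewrite -addrA addr_eq0 => /eqP ->; rewrite opprD opprK.
have -> : leg13_12 s r - leg12_23 s s = - leg23_13 s s.
  by apply/eqP; rewrite -addr_eq0 eq_s.
rewrite (linear_oppE _ (triple_right_act_linear _)).
by rewrite opprK opprB addrA addrAC.
Qed.

(** * From Yang-Baxter pairs to unitary bialgebras *)

Theorem aBHYB_covariant r s :
  bihom_invariant r -> bihom_invariant s ->
  aBHYB_pair mu alpha beta psi omega r s ->
  covariant_bihom_bialgebra mu alpha beta psi omega
    (inner_map r r) (inner_map s s) (inner_map r s).
Proof.
move=> ri si rs; case: (ri) => ra rb rp ro; case: (si) => sa sb sp so.
split=> //; try exact: inner_derivation; try exact: commutes_inner_map.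
- exact: aBHYB_inner_coassociative.
(* The free tensor of the Leibniz rule is r here and s in the next case. *)
- by move=> a b; rewrite addrC; apply: inner_map_leibniz.
- by move=> a b; apply: inner_map_leibniz.
Qed.

Section Unit.
Variable one : A.
Hypothesis A_unit : bihom_unit mu alpha beta one.
Hypotheses (psi_one : psi one = one) (omega_one : omega one = one).

Let mul1 a : one *m* a = beta a.
Proof. by case: A_unit. Qed.
Let mulr1 a : a *m* one = alpha a.
Proof. by case: A_unit. Qed.
Let alpha_one : alpha one = one.
Proof. by case: A_unit. Qed.
Let beta_one : beta one = one.
Proof. by case: A_unit. Qed.
Let alphai_one : alphai one = one.
Proof. by rewrite -{1}alpha_one alphaK. Qed.
Let betai_one : betai one = one.
Proof. by rewrite -{1}beta_one betaK. Qed.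

Let unitE := (psi_one, omega_one, alpha_one, beta_one, mul1, mulr1).

Lemma inner_map_one p q : invariant beta p -> invariant alpha q ->
  inner_map p q one = p - q.
Proof.
move=> pb qa; rewrite /inner_map alphai_one betai_one.
rewrite -[p in RHS]pb -[q in RHS]qa; congr (_ - _).
  by apply: eq_tens_sum => x y; rewrite !unitE.
by apply: eq_tens_sum => x y; rewrite !unitE.
Qed.

(** The three ways to insert a unit in an element of A (x) A; the middle one has
    to carry omega and psi, which invariance does not remove because they act on
    different factors. *)
Definition unit_tens_l (t : tensor A A) := \tsum_(x, y <- t) (one \ox x \ox y).
Definition unit_tens_m (t : tensor A A) :=
  \tsum_(x, y <- t) (omega x \ox one \ox psi y).
Definition unit_tens_r (t : tensor A A) := \tsum_(x, y <- t) (x \ox y \ox one).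

Lemma leg12_23_linearl q : linear (leg12_23 ^~ q).
Proof. by apply: tens_sum_linear; bilinear_tac. Qed.
Lemma leg12_23_linearr p : linear (leg12_23 p).
Proof.
move=> k t u; rewrite /leg12_23 ![\tsum_(_, _ <- p) _]tens_sum_exchange.
by apply: tens_sum_linear; bilinear_tac.
Qed.
Lemma leg13_12_linearl q : linear (leg13_12 ^~ q).
Proof. by apply: tens_sum_linear; bilinear_tac. Qed.
Lemma leg23_13_linearl q : linear (leg23_13 ^~ q).
Proof. by apply: tens_sum_linear; bilinear_tac. Qed.
Lemma leg23_13_linearr p : linear (leg23_13 p).
Proof.
move=> k t u; rewrite /leg23_13 ![\tsum_(_, _ <- p) _]tens_sum_exchange.
by apply: tens_sum_linear; bilinear_tac.
Qed.

Lemma leg13_12_one t : invariant beta t ->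
  leg13_12 (one \ox one) t = unit_tens_r t.
Proof.
move=> tb; rewrite /leg13_12 tens_sum_tens; last by bilinear_tac.
rewrite -[RHS](tens_sum_invariant (linearP beta) tb); last by bilinear_tac.
by apply: eq_tens_sum => x y; rewrite !unitE.
Qed.

Lemma leg12_23_one_l t : invariant beta t ->
  leg12_23 (one \ox one) t = unit_tens_l t.
Proof.
move=> tb; rewrite /leg12_23 tens_sum_tens; last by bilinear_tac.
rewrite -[RHS](tens_sum_invariant (linearP beta) tb); last by bilinear_tac.
by apply: eq_tens_sum => x y; rewrite !unitE.
Qed.

Lemma leg12_23_one_r t : invariant alpha t ->
  leg12_23 t (one \ox one) = unit_tens_r t.
Proof.
move=> ta; rewrite -[RHS](tens_sum_invariant (linearP alpha) ta);
  last by bilinear_tac.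
apply: eq_tens_sum => x y; rewrite tens_sum_tens; last by bilinear_tac.
by rewrite !unitE.
Qed.

Lemma leg23_13_one_l t : invariant beta t ->
  leg23_13 (one \ox one) t = unit_tens_m t.
Proof.
move=> tb; rewrite /leg23_13 tens_sum_tens; last by bilinear_tac.
rewrite -[RHS](tens_sum_invariant (linearP beta) tb); last by bilinear_tac.
by apply: eq_tens_sum => x y; rewrite !(unitE, bihomE).
Qed.

Lemma leg23_13_one_r t : invariant alpha t ->
  leg23_13 t (one \ox one) = unit_tens_l t.
Proof.
move=> ta; rewrite -[RHS](tens_sum_invariant (linearP alpha) ta);
  last by bilinear_tac.
apply: eq_tens_sum => x y; rewrite tens_sum_tens; last by bilinear_tac.
by rewrite !unitE.
Qed.

Lemma unit_invariant F : linear F -> F one = one -> invariant F (one \ox one).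
Proof. by move=> lF F1; rewrite /tens_invariant tens_map_tens // F1. Qed.

(** The terms r (x) 1, 1 (x) r and 1 (x) 1 (x) 1 produced by expanding s in the
    second equation cancel in pairs, so both equations have the same content. *)
Lemma aBHYB_pair_unit r : bihom_invariant r ->
  aBHYB_pair mu alpha beta psi omega r (r - one \ox one) <->
  unit_tens_m r = leg13_12 r r - leg12_23 r r + leg23_13 r r.
Proof.
case=> ra rb rp ro.
have ua := unit_invariant (linearP alpha) alpha_one.
have ub := unit_invariant (linearP beta) beta_one.
have unit_l : unit_tens_l (one \ox one) = one \ox one \ox one.
  by apply: tens_sum_tens; bilinear_tac.
set s := r - _; set defect := leg13_12 r r - leg12_23 r r + leg23_13 r r.
have s_r : leg23_13 s r = leg23_13 r r - unit_tens_m r.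
  by rewrite (linear_sub _ _ (leg23_13_linearl _)) leg23_13_one_l.
have E1 : leg13_12 r r - leg12_23 r r + leg23_13 s r = defect - unit_tens_m r.
  by rewrite s_r addrA.
have E2 : leg13_12 s r - leg12_23 s s + leg23_13 s s = defect - unit_tens_m r.
  have -> : leg13_12 s r = leg13_12 r r - unit_tens_r r.
    by rewrite (linear_sub _ _ (leg13_12_linearl _)) leg13_12_one.
  have -> : leg12_23 s s = leg12_23 r r - unit_tens_r r
                           - (unit_tens_l r - one \ox one \ox one).
    rewrite {1}/s (linear_sub _ _ (leg12_23_linearl _)) /s.
    rewrite !(linear_sub _ _ (leg12_23_linearr _)).
    by rewrite leg12_23_one_r // !leg12_23_one_l // unit_l.
  have -> : leg23_13 s s = leg23_13 r r - unit_tens_m r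
                           - (unit_tens_l r - one \ox one \ox one).
    rewrite (linear_sub _ _ (leg23_13_linearr _)) s_r.
    rewrite (linear_sub _ _ (leg23_13_linearl _)).
    by rewrite !leg23_13_one_r // unit_l.
  have cancel_units (V : zmodType) (x y v z u : V) :
      x - y - (v - y - z) + (u - z) = x - v + u.
    rewrite opprB opprB [z + (y - v)]addrC (addrA (x - y)) subrKA -addrA.
    by rewrite [z + _]addrC subrK.
  by rewrite cancel_units addrA.
rewrite /aBHYB_pair E1 E2; split=> [[/eqP]|->]; last by rewrite subrr.
by rewrite subr_eq0 => /eqP.
Qed.

Section UnitalPair.
Variable r : tensor A A.
Hypothesis r_inv : bihom_invariant r.
Local Notation s := (r - one \ox one).
Local Notation defect := (leg13_12 r r - leg12_23 r r + leg23_13 r r).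

Lemma omega_inner_unit :
  tens_assoc (tens_map omega (inner_map r s) r) = leg13_12 r r
  <-> unit_tens_m r = defect.
Proof.
case: (r_inv) => ra rb rp ro.
rewrite tens_map_omega_inner // (linear_sub _ _ (leg23_13_linearl _)).
rewrite leg23_13_one_l // opprB addrCA; split=> [<-|->].
  rewrite -addrA [- _ + leg23_13 r r]addrC.
  by rewrite -[leg23_13 r r - _]opprB addrK.
rewrite -(addrA (leg13_12 r r)) [- _ + leg23_13 r r]addrC.
by rewrite -[leg23_13 r r - _]opprB subrK.
Qed.

Lemma inner_psi_unit :
  tens_map (inner_map r s) psi r
    = - leg23_13 r r + unit_tens_l r + unit_tens_m r
  <-> unit_tens_m r = defect.
Proof.
case: (r_inv) => ra rb rp ro.
rewrite tens_map_inner_psi // (linear_sub _ _ (leg12_23_linearl _)).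
rewrite leg12_23_one_l // opprB addrCA [- _ + unit_tens_l r]addrC -addrA.
rewrite [- _ + unit_tens_m r]addrC.
by split=> [/addrI ->|->]; rewrite ?subrK ?addrK.
Qed.

End UnitalPair.

Theorem unitary_quasitriangular_iff r s :
  bihom_invariant r -> bihom_invariant s ->
  let unitary_quasitriangular :=
    quasitriangular_covariant_bihom_bialgebra mu alpha beta psi omega r s
      (inner_map r r) (inner_map s s) (inner_map r s)
    /\ unitary_coproduct one (inner_map r s) in
  (unitary_quasitriangular <->
     s = r - one \ox one /\
     unit_tens_m r = leg13_12 r r - leg12_23 r r + leg23_13 r r)
  /\
  (unitary_quasitriangular <->
     s = r - one \ox one /\
     (tens_assoc (tens_map omega (inner_map r s) r) = leg13_12 r r
      /\ tens_map (inner_map r s) psi r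
           = - leg23_13 r r + unit_tens_l r + unit_tens_m r)).
Proof.
move=> ri si unitary_qt.
have qtP : unitary_qt <->
    s = r - one \ox one /\
    unit_tens_m r = leg13_12 r r - leg12_23 r r + leg23_13 r r.
  case: (ri) => _ rb _ _; case: (si) => sa _ _ _.
  rewrite /unitary_qt /unitary_coproduct inner_map_one //; split.
    case=> -[_ pair_rs] r_s; have sE : s = r - one \ox one.
      by rewrite -r_s opprB addrC subrK.
    by split=> //; apply/(aBHYB_pair_unit ri); rewrite -sE.
  case=> sE /(aBHYB_pair_unit ri); rewrite -sE => pair_rs.
  split; last by rewrite sE opprB addrC subrK.
  by split=> //; apply: aBHYB_covariant.
split=> //; rewrite qtP; split=> -[sE]; rewrite sE.
  by move=> eq_r; split=> //; split; [apply/omega_inner_unit|apply/inner_psi_unit].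
by case=> /(omega_inner_unit ri) eq_r _; split.
Qed.

End Unit.

End BiHomBialgebra.

Theorem proposition2p33
  (K : fieldType) (A : lmodType K)
  (mu : {linear tensor A A -> A}) (one : A)
  (alpha beta psi omega : {linear A -> A})
  (alphai betai : A -> A)
  (A_assoc : bihom_associative mu alpha beta)
  (A_unit : bihom_unit mu alpha beta one)
  (alphaK : cancel alpha alphai) (alphaiK : cancel alphai alpha)
  (betaK : cancel beta betai) (betaiK : cancel betai beta)
  (psi_alpha : psi \o alpha =1 alpha \o psi)
  (psi_beta : psi \o beta =1 beta \o psi)
  (omega_alpha : omega \o alpha =1 alpha \o omega)
  (omega_beta : omega \o beta =1 beta \o omega)
  (psi_omega : psi \o omega =1 omega \o psi)
  (psi_mul : mu_multiplicative mu psi)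
  (omega_mul : mu_multiplicative mu omega)
  (psi_one : psi one = one) (omega_one : omega one = one)
  (r s : tensor A A)
  (r_alpha : tens_invariant alpha r) (r_beta : tens_invariant beta r)
  (r_psi : tens_invariant psi r) (r_omega : tens_invariant omega r)
  (s_alpha : tens_invariant alpha s) (s_beta : tens_invariant beta s)
  (s_psi : tens_invariant psi s) (s_omega : tens_invariant omega s)
  (delta_r delta_s Delta : A -> tensor A A)
  (delta_rE : forall a, delta_r a =
     left_act mu beta omega (alphai a) r - right_act mu alpha psi r (betai a))
  (delta_sE : forall a, delta_s a =
     left_act mu beta omega (alphai a) s - right_act mu alpha psi s (betai a))
  (DeltaE : forall a, Delta a =
     left_act mu beta omega (alphai a) r - right_act mu alpha psi s (betai a)) :
  let unitary_quasitriangular :=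
    quasitriangular_covariant_bihom_bialgebra
      mu alpha beta psi omega r s delta_r delta_s Delta
    /\ unitary_coproduct one Delta in
  (unitary_quasitriangular <->
     s = r - one \ox one /\
     \tsum_(r1, r2 <- r) (omega r1 \ox one \ox psi r2)
       = leg13_12 mu alpha beta psi omega r r - leg12_23 mu alpha beta r r
         + leg23_13 mu alpha beta psi omega r r)
  /\
  (unitary_quasitriangular <->
     s = r - one \ox one /\
     (tens_assoc (tens_map omega Delta r)
        = leg13_12 mu alpha beta psi omega r r
      /\
      tens_map Delta psi r
        = - leg23_13 mu alpha beta psi omega r r
          + \tsum_(r1, r2 <- r) (one \ox r1 \ox r2)
          + \tsum_(r1, r2 <- r) (omega r1 \ox one \ox psi r2))).
Proof.
pose ai : {linear A -> A} :=
  HB.pack alphai (GRing.isLinear.Build _ _ _ _ _ (can2_linear alphaK alphaiK)).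
pose bi : {linear A -> A} :=
  HB.pack betai (GRing.isLinear.Build _ _ _ _ _ (can2_linear betaK betaiK)).
pose D := inner_map mu alpha beta psi omega ai bi.
have -> : delta_r = D r r by apply/funext=> a; rewrite delta_rE.
have -> : delta_s = D s s by apply/funext=> a; rewrite delta_sE.
have -> : Delta = D r s by apply/funext=> a; rewrite DeltaE.
exact: unitary_quasitriangular_iff.
Qed.
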